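(* Let $\mathcal G$ be a graph on $n$ vertices. Let $u_0,u_1,\dots,u_{n-1}$ be an orthonormal basis of $\mathbb R^n$ consisting of eigenvectors of $\mathcal L=D^{-1/2}AD^{-1/2}$, with $u_0=(\sqrt{\widetilde p(1)},\dots,\sqrt{\widetilde p(n)})^T$ the trivial eigenvector (eigenvalue $1$), and let $\widetilde\lambda_k$ be the eigenvalue of $u_k$. Put $\widetilde\phi_k=D_{\widetilde p}^{-1/2}u_k$ for $k=1,\dots,n-1$. Then for every positive integer $t$ and all vertices $x,y$, $$\frac{\widetilde p(t,y|x)}{\widetilde p(y)}=1+\sum_{k=1}^{n-1}\widetilde\lambda_k^{\,t}\,\widetilde\phi_k(x)\,\widetilde\phi_k(y).$$
   Context: $\mathcal G$ is an undirected, possibly weighted, graph with vertex set $\{1,\dots,n\}$ and symmetric adjacency matrix $A$ with nonnegative entries; $d_x=\sum_yA(x,y)>0$ is the degree of $x$; $D=\mathrm{diag}(d_1,\dots,d_n)$; $N=\sum_{x,y}A(x,y)$; $\widetilde p(x)=d_x/N$; $D_{\widetilde p}=\mathrm{diag}(\widetilde p(1),\dots,\widetilde p(n))$. The paper's convention is to call $\mathcal L=D^{-1/2}AD^{-1/2}$ the graph Laplacian. $\mathcal T=D^{-1}A$ is the transition matrix of the random walk on $\mathcal G$, for which $\widetilde p$ is a stationary distribution, and $\widetilde p(t,y|x)=\mathcal T^t(x,y)$ is the probability that the walk started at $x$ is at $y$ after $t$ steps. For $t=1$ the left-hand side is the empirical GraField of $\mathcal G$ expressed in the vertex domain. *)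

(* Defs.v *)
From mathcomp Require Import all_boot all_order all_algebra.
From mathcomp Require Import reals.

Set Implicit Arguments.
Unset Strict Implicit.
Unset Printing Implicit Defensive.

Import Order.TTheory GRing.Theory Num.Theory.
Local Open Scope ring_scope.

(* Vectors of R^n acted on by matrices are columns 'cV[R]_n; the families from
   which diagonal matrices are built are rows, as diag_mx expects. *)

(* Self-loops are allowed; the vertices {1, .., n} are represented by 'I_n. *)
Definition weighted_adjacency (R : realType) (n : nat) (A : 'M[R]_n) : Prop :=
  (forall x y, A x y = A y x) /\ (forall x y, 0 <= A x y).

Definition degree (R : realType) (n : nat) (A : 'M[R]_n) : 'rV[R]_n :=
  \row_x \sum_y A x y.

Definition total_weight (R : realType) (n : nat) (A : 'M[R]_n) : R :=
  \sum_x \sum_y A x y.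

Definition stationary (R : realType) (n : nat) (A : 'M[R]_n) : 'rV[R]_n :=
  \row_x (degree A 0 x / total_weight A).

(* diag(d)^{-1/2}, meaningful when all the entries of d are positive. *)
Definition diag_inv_sqrt (R : realType) (n : nat) (d : 'rV[R]_n) : 'M[R]_n :=
  diag_mx (\row_x (Num.sqrt (d 0 x))^-1).

(* D^{-1/2} A D^{-1/2}, without subtraction from the identity. *)
Definition laplacian (R : realType) (n : nat) (A : 'M[R]_n) : 'M[R]_n :=
  diag_inv_sqrt (degree A) *m A *m diag_inv_sqrt (degree A).

Definition transition (R : realType) (n : nat) (A : 'M[R]_n) : 'M[R]_n :=
  invmx (diag_mx (degree A)) *m A.

(* p(t, y | x): the walk starts at x and is at y after t steps. *)
Definition walk_prob (R : realType) (n : nat) (A : 'M[R]_n)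
    (t : nat) (y x : 'I_n) : R :=
  (transition A ^+ t) x y.

Definition orthonormal_basis (R : realType) (n : nat) (u : 'I_n -> 'cV[R]_n) :
    Prop :=
  basis_of fullv [seq u k | k : 'I_n] /\
  forall j k, \sum_x u j x 0 * u k x 0 = (j == k)%:R.

(* The eigenvector v is a column: the library's eigenvalue and eigenspace
   refer to the action of a matrix on row vectors. *)
Definition eigenpair (R : realType) (n : nat) (M : 'M[R]_n)
    (a : R) (v : 'cV[R]_n) : Prop :=
  v != 0 /\ M *m v = a *: v.

(* Main.v *)
Require Import Defs.
From mathcomp Require Import all_boot all_order all_algebra.
From mathcomp Require Import reals.

(** The matrix S = D_p^{-1/2}, where p is the stationary distribution,
    intertwines the walk and the Laplacian: T S = S L
    ([transition_intertwines_laplacian]).  Hence phi_k = S u_k is an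
    eigenvector of T with the eigenvalue of u_k, and T^t phi_k =
    lambda_k^t phi_k.

    The u_k are orthonormal and as many as the dimension, so they also
    resolve the identity, sum_k u_k u_k^T = 1 ([orthonormal_resolution]).
    Multiplying by S on both sides gives sum_k phi_k phi_k^T = D_p^{-1},
    and then applying T^t gives
      T^t D_p^{-1} = sum_k lambda_k^t phi_k phi_k^T,
    whose (x, y) entry is the expansion sought.  The term k = 0 is 1 because
    phi_0 = S u_0 is the constant vector 1, which T fixes as its rows sum to 1;
    this also forces lambda_0 = 1. *)

Import Order.TTheory GRing.Theory Num.Theory.
Local Open Scope ring_scope.

Lemma expmx_eigenvector {R : comPzRingType} {n : nat} {M : 'M[R]_n.+1} {a : R}
    {v : 'cV[R]_n.+1} (t : nat) :
  M *m v = a *: v -> M ^+ t *m v = a ^+ t *: v.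
Proof.
move=> Mv; elim: t => [|t IH]; first by rewrite !expr0 mul1mx scale1r.
by rewrite exprSr -mulmxA Mv -scalemxAr IH scalerA -exprS.
Qed.

(** For the square matrix U with columns u_k, orthonormality says U^T U = 1;
    a one-sided inverse of a square matrix is two-sided, so U U^T = 1. *)
Lemma orthonormal_resolution {R : comUnitRingType} {n : nat}
    {u : 'I_n -> 'cV[R]_n} :
  (forall j k, \sum_x u j x 0 * u k x 0 = (j == k)%:R) ->
  \sum_k u k *m (u k)^T = 1%:M.
Proof.
move=> orth; pose U := \matrix_(x, k) u k x 0.
have UtU : U^T *m U = 1%:M.
  apply/matrixP=> j k; rewrite !mxE -orth.
  by apply: eq_bigr => x _; rewrite !mxE.
rewrite -(mulmx1C UtU); apply/matrixP=> x y; rewrite summxE !mxE.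
by apply: eq_bigr => k _; rewrite !mxE big_ord1 !mxE.
Qed.

Lemma unitmx_diag_gt0 {R : realType} {n : nat} {d : 'rV[R]_n} :
  (forall x, 0 < d 0 x) -> diag_mx d \in unitmx.
Proof.
move=> d_gt0; rewrite unitmxE det_diag unitfE.
by apply/prodf_neq0 => x _; rewrite gt_eqF.
Qed.

Lemma diag_inv_sqrt_sq {R : realType} {n : nat} {d : 'rV[R]_n} :
  (forall x, 0 < d 0 x) ->
  diag_inv_sqrt d *m diag_inv_sqrt d = invmx (diag_mx d).
Proof.
move=> d_gt0; set S := diag_inv_sqrt d.
have SSD : S *m S *m diag_mx d = 1%:M.
  rewrite !mulmx_diag; apply/matrixP=> i j; rewrite !mxE.
  by rewrite -invfM -expr2 sqr_sqrtr ?ltW // mulVf // gt_eqF.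
by rewrite -[LHS](mulmxK (unitmx_diag_gt0 d_gt0)) SSD mul1mx.
Qed.

Section PositiveDegrees.

Context {R : realType} {n : nat} {A : 'M[R]_n.+1}.
Hypothesis degree_gt0 : forall x, 0 < degree A 0 x.

Lemma total_weight_gt0 : 0 < total_weight A.
Proof.
have row_gt0 x : 0 < \sum_y A x y by move: (degree_gt0 x); rewrite mxE.
rewrite /total_weight big_ord_recl; apply: ltr_wpDr (row_gt0 _).
by apply: sumr_ge0 => x _; apply: ltW.
Qed.

Lemma stationary_gt0 x : 0 < stationary A 0 x.
Proof. by rewrite mxE divr_gt0 ?total_weight_gt0. Qed.

Lemma transition_const1 : transition A *m const_mx 1 = const_mx 1 :> 'cV_n.+1.
Proof.
have A1 : A *m const_mx 1 = diag_mx (degree A) *m const_mx 1 :> 'cV_n.+1.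
  rewrite mul_diag_mx; apply/colP=> x; rewrite !mxE mulr1.
  by apply: eq_bigr => y _; rewrite mxE mulr1.
by rewrite /transition -mulmxA A1 mulKmx // unitmx_diag_gt0.
Qed.

(** T = D^{-1} A and L = D^{-1/2} A D^{-1/2} are conjugate under D^{1/2};
    D_p^{-1/2} is D^{-1/2} up to the scalar sqrt N, so it conjugates them too. *)
Lemma transition_intertwines_laplacian :
  transition A *m diag_inv_sqrt (stationary A) =
  diag_inv_sqrt (stationary A) *m laplacian A.
Proof.
have -> : diag_inv_sqrt (stationary A) =
          Num.sqrt (total_weight A) *: diag_inv_sqrt (degree A).
  rewrite /diag_inv_sqrt -linearZ; congr diag_mx; apply/rowP=> x.
  have -> : stationary A = \row_z (degree A 0 z / total_weight A) by [].
  move: (degree A) (degree_gt0 x) total_weight_gt0 => d dx_gt0 N_gt0.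
  by rewrite !mxE sqrtrM ?ltW // sqrtrV ?ltW // invfM invrK mulrC.
rewrite -scalemxAr -scalemxAl /transition -(diag_inv_sqrt_sq degree_gt0).
by rewrite /laplacian !mulmxA.
Qed.

End PositiveDegrees.

Theorem theorem6 (R : realType) (n : nat) (A : 'M[R]_n.+1)
    (u : 'I_n.+1 -> 'cV[R]_n.+1) (lambda : 'I_n.+1 -> R)
    (phi : 'I_n.+1 -> 'cV[R]_n.+1) :
  weighted_adjacency A ->
  (forall x, 0 < degree A 0 x) ->
  orthonormal_basis u ->
  (forall k, eigenpair (laplacian A) (lambda k) (u k)) ->
  u ord0 = \col_x Num.sqrt (stationary A 0 x) ->
  (forall k, k != ord0 -> phi k = diag_inv_sqrt (stationary A) *m u k) ->
  forall (t : nat) (x y : 'I_n.+1), (0 < t)%N ->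
    walk_prob A t y x / stationary A 0 y =
    1 + \sum_(k < n.+1 | k != ord0) lambda k ^+ t * phi k x 0 * phi k y 0.
Proof.
move=> _ degree_gt0 [_ orth] eigen_u u0E phiE t x y _.
set p := stationary A; pose S := diag_inv_sqrt p; pose T := transition A.
have p_gt0 z : 0 < p 0 z by apply: stationary_gt0.
(* phi is given only for k != 0, but the resolution of the identity needs
   every k; psi is phi completed by the constant vector at k = 0. *)
pose psi k := S *m u k.
have psi_eigen k : T *m psi k = lambda k *: psi k.
  have [_ Lu] := eigen_u k.
  by rewrite /psi mulmxA transition_intertwines_laplacian // -mulmxA Lu -scalemxAr.
have psi0 : psi ord0 = const_mx 1.
  rewrite /psi u0E /S mul_diag_mx -/p; clearbody p.
  by apply/colP=> z; rewrite !mxE mulVf // gt_eqF // sqrtr_gt0.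
have lambda0 : lambda ord0 = 1.
  move: (psi_eigen ord0); rewrite psi0 transition_const1 //.
  by move/colP/(_ ord0); rewrite !mxE mulr1 => <-.
have psi_resolution : \sum_k psi k *m (psi k)^T = invmx (diag_mx p).
  have ST : S^T = S by rewrite /S /diag_inv_sqrt tr_diag_mx.
  rewrite -(diag_inv_sqrt_sq p_gt0) -/S -[X in X *m _]mulmx1.
  rewrite -(orthonormal_resolution orth) mulmx_sumr mulmx_suml.
  by apply: eq_bigr => k _; rewrite /psi trmx_mul ST !mulmxA.
have expansion :
    T ^+ t *m invmx (diag_mx p) = \sum_k lambda k ^+ t *: (psi k *m (psi k)^T).
  rewrite -psi_resolution mulmx_sumr; apply: eq_bigr => k _.
  by rewrite mulmxA (expmx_eigenvector t (psi_eigen k)) -scalemxAl.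
have -> : walk_prob A t y x / p 0 y = (T ^+ t *m invmx (diag_mx p)) x y.
  rewrite -(diag_inv_sqrt_sq p_gt0) mulmx_diag mul_mx_diag /walk_prob -/T.
  set Tt := T ^+ t; clearbody p Tt; rewrite !mxE.
  by rewrite -invfM -expr2 sqr_sqrtr // ltW.
rewrite expansion summxE (bigD1 ord0) //=; congr (_ + _).
  by rewrite lambda0 expr1n scale1r psi0 !mxE big_ord1 !mxE mulr1.
apply: eq_bigr => k k_neq0; rewrite phiE // -/p -/S -/(psi k).
by rewrite mxE (mxE _ _ x) big_ord1 (mxE _ _ _ y) mulrA.
Qed.
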